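(* The Game of Life $g$ restricted to its limit set $\Omega(g) = \bigcap_{n \geq 0} g^n(\{0,1\}^{\mathbb{Z}^2})$ is not topologically transitive, and does not have dense periodic points.
   Context: The Game of Life is the map $g : \{0,1\}^{\mathbb{Z}^2} \to \{0,1\}^{\mathbb{Z}^2}$ defined as follows. Let $K = \{-1,0,1\}^2 \setminus \{(0,0)\}$. For $x \in \{0,1\}^{\mathbb{Z}^2}$ and $\vec v \in \mathbb{Z}^2$, put $s = \sum_{\vec u \in K} x_{\vec v + \vec u}$. Then $g(x)_{\vec v} = 1$ if and only if ($x_{\vec v} = 0$ and $s = 3$) or ($x_{\vec v} = 1$ and $s \in \{2,3\}$). The space $\{0,1\}^{\mathbb{Z}^2}$ has the product topology and $\Omega(g)$ the induced topology. A continuous map $f : X \to X$ is topologically transitive if for all nonempty open sets $U, V \subset X$ we have $f^n(U) \cap V \neq \emptyset$ for some $n \in \mathbb{N}$. It has dense periodic points if the set of its temporally periodic points, i.e. those $x \in X$ with $f^n(x) = x$ for some $n \geq 1$, is dense in $X$. *)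

(* Defs.v *)
From HB Require Import structures.
From mathcomp Require Import all_boot all_order all_algebra.
From mathcomp Require Import all_classical topology.
Set Implicit Arguments.
Unset Strict Implicit.
Unset Printing Implicit Defensive.
Import GRing.Theory.
Local Open Scope classical_set_scope.
Local Open Scope ring_scope.

(* [n] ranges over all naturals, 0 included. *)
Definition topologically_transitive (X : topologicalType) (f : X -> X) : Prop :=
  forall U V : set X, open U -> open V -> U !=set0 -> V !=set0 ->
    exists n : nat, (iter n f @` U) `&` V !=set0.

Definition periodic_points (X : Type) (f : X -> X) : set X :=
  [set x | exists2 n : nat, (1 <= n)%N & iter n f x = x].

Definition has_dense_periodic_points (X : topologicalType) (f : X -> X) : Prop :=
  dense (periodic_points f).

Definition limit_set (X : Type) (f : X -> X) : set X :=
  \bigcap_(n : nat) (iter n f @` [set: X]).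

Lemma limit_set_stable (X : Type) (f : X -> X) :
  {homo f : x / limit_set f x >-> limit_set f x}.
Proof.
move=> x Ox n _; have [y _ <-] := Ox n I.
by exists (f y) => //; rewrite -iterSr.
Qed.

(* [limit_set f], coerced to a type, carries the topology induced by [X]. *)
Definition restr_limit_set (X : Type) (f : X -> X) :
    limit_set f -> limit_set f :=
  sigLR (mkfun (@limit_set_stable X f)).

Arguments restr_limit_set {X} f x.

(* [bool] carries the discrete topology, [{ptws _ -> _}] the product one. *)
Notation configuration := {ptws int * int -> bool}.

Definition moore : seq (int * int) :=
  [seq u <- [seq (i, j) | i <- [:: -1; 0; 1], j <- [:: -1; 0; 1]] | u != (0, 0)].

Definition live_neighbors (x : configuration) (v : int * int) : nat :=
  \sum_(u <- moore) nat_of_bool (x (v + u)%R).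

Definition game_of_life (x : configuration) : configuration := fun v =>
  let s := live_neighbors x v in
  ~~ x v && (s == 3%N) || x v && (s \in [:: 2%N; 3%N]).

(* Main.v *)
Require Import Defs.
From HB Require Import structures.
From Stdlib Require Import BinPos BinNat Ascii String.
From mathcomp Require Import all_boot all_order all_algebra.
From mathcomp Require Import all_classical topology.
From mathcomp Require Import zify.

(** Let [S] be the finite still life [still_life] below, and [D] the rectangle
    [region]. If [game_of_life x] agrees with [S] on [D], then so does [x]: on
    [D] the figure consists of rows OO-OO- and O--O--, with one shift in the
    first and the last, and their phases are such that no other preimage of the
    pattern exists. This finite statement is proved by resolution; the
    refutation is found by a conflict-driven search and checked by a verified
    checker. Hence the orbit of a point that differs from [S] on [D] never
    enters the cylinder that [S] defines on [D], so there is no transitivity. On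
    the other hand a glider can come from infinity, so that the resulting
    configuration is in the limit set, and destroy [S] on [D]. A periodic point
    near the configuration just before the collision would leave the cylinder
    and return to it, which is impossible. *)

Set Implicit Arguments.
Unset Strict Implicit.
Unset Printing Implicit Defensive.

(** * Tries indexed by binary numbers *)

Lemma pos_eqbP : Equality.axiom BinPos.Pos.eqb.
Proof. by move=> p q; apply: BinPos.Pos.eqb_spec. Qed.
HB.instance Definition _ := hasDecEq.Build positive pos_eqbP.

Inductive trie (A : Type) := Leaf | Node of trie A & option A & trie A.
Arguments Leaf {A}.

Fixpoint get A (p : positive) (t : trie A) : option A :=
  match t, p with
  | Leaf, _ => None
  | Node _ x _, xH => x
  | Node l _ _, xO q => get q l
  | Node _ _ r, xI q => get q r
  end.

Fixpoint put A (p : positive) (a : A) (t : trie A) : trie A :=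
  match p, t with
  | xH, Leaf => Node Leaf (Some a) Leaf
  | xH, Node l _ r => Node l (Some a) r
  | xO q, Leaf => Node (put q a Leaf) None Leaf
  | xO q, Node l x r => Node (put q a l) x r
  | xI q, Leaf => Node Leaf None (put q a Leaf)
  | xI q, Node l x r => Node l x (put q a r)
  end.

Definition put_all A (s : seq (positive * A)) (t : trie A) : trie A :=
  foldl (fun t pa => put pa.1 pa.2 t) t s.

Lemma get_put A p q (a : A) t :
  get p (put q a t) = if p == q then Some a else get p t.
Proof.
by elim: q p t => [q IHq|q IHq|] [p|p|] [|l x r]; rewrite /= ?IHq //; case: p.
Qed.

Lemma get_put_all (A : eqType) p (s : seq (positive * A)) t a :
  get p (put_all s t) = Some a -> (p, a) \in s \/ get p t = Some a.
Proof.
elim: s t => [|[q b] s IHs] t /=; first by right.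
case/IHs => [ps|]; first by left; rewrite inE ps orbT.
by rewrite get_put; case: eqP => [->[->]|_]; [left; apply: mem_head | right].
Qed.

(** * Boolean constraints and their propagation *)

Definition life_rule (c : bool) (s : nat) : bool :=
  ~~ c && (s == 3) || c && (s \in [:: 2; 3]).

(* [get v bd = Some (Some t, us)] is the constraint that the cell [v], whose
   neighbours are [us], has value [t] one step later; with [None] in place of
   [Some t] the cell [v] is unconstrained. *)
Definition board := trie (option bool * seq positive).

Definition assignment := trie bool.

Definition satisfies (X : positive -> bool) (bd : board) :=
  forall v t us, get v bd = Some (Some t, us) ->
    life_rule (X v) (\sum_(u <- us) X u) = t.

(* Can a cell in state [c] ([None] if unknown) with at least [a] and at most
   [b] live neighbours take the value [t]? *)
Definition feasible (t : bool) (c : option bool) (a b : nat) : bool :=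
  if t then (a <= 3) && (3 <= b)
            || (c != Some false) && ((a <= 2) && (2 <= b))
  else (a <= 1) || (4 <= b) || (c != Some true) && ((a <= 2) && (2 <= b)).

Fixpoint tally (s : seq (positive * option bool)) : nat * nat :=
  if s is (_, o) :: s then
    let: (a, d) := tally s in
    match o with
    | Some true => (a.+1, d) | Some false => (a, d.+1) | None => (a, d)
    end
  else (0, 0).

Fixpoint force (b : bool) (s : seq (positive * option bool)) :
    seq (positive * bool) :=
  match s with
  | [::] => [::]
  | (p, None) :: s => (p, b) :: force b s
  | _ :: s => force b s
  end.

(* The values forced by the constraint at [v], or [None] if it is violated. *)
Definition cell_step (bd : board) (asg : assignment) (v : positive) :
    option (seq (positive * bool)) :=
  match get v bd with
  | Some (Some t, us) =>
    let nb := [seq (u, get u asg) | u <- us] in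
    let: (a, d) := tally nb in
    let b := size us - d in
    let c := get v asg in
    if ~~ feasible t c a b then None else
    let fc := if c is None then
        if ~~ feasible t (Some true) a b then [:: (v, false)]
        else if ~~ feasible t (Some false) a b then [:: (v, true)] else [::]
      else [::] in
    let fn := if a == b then [::]
      else if ~~ feasible t c a.+1 b then force false nb
      else if ~~ feasible t c a b.-1 then force true nb else [::] in
    Some (fc ++ fn)
  | _ => Some [::]
  end.

(* A literal is a positive whose last bit is the claimed value of the variable
   given by the other bits. *)
Definition lit (v : positive) (b : bool) : positive := if b then xI v else xO v.
Definition var (l : positive) : positive :=
  match l with xI v | xO v => v | xH => xH end.
Definition sign (l : positive) : bool := if l is xI _ then true else false.
Definition opp (l : positive) : positive := lit (var l) (~~ sign l).
Definition value (asg : assignment) (l : positive) : option bool :=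
  omap (eqb (sign l)) (get (var l) asg).

Definition holds (X : positive -> bool) (l : positive) : bool :=
  sign l == X (var l).

Lemma holds_lit X v b : holds X (lit v b) = (b == X v).
Proof. by case: b. Qed.

(** * Checking a refutation *)

(* A derived clause, its identifier, and the reasons that produce a
   contradiction when they are propagated, in order, after negating the clause:
   the constraint at [v] is [xI v] and the clause number [i] is [xO i]. *)
Record line := Line {
  clause : seq positive; hints : seq positive; number : positive }.

Definition clause_step (asg : assignment) (cl : seq positive) :
    option assignment :=
  match [seq l <- cl | value asg l != Some false] with
  | [::] => None
  | [:: l] => Some (put (var l) (sign l) asg)
  | _ => Some asg
  end.

Definition hint_step (bd : board) (db : trie (seq positive))
    (asg : assignment) (h : positive) : option assignment :=
  match h with
  | xI v => omap (fun s => put_all s asg) (cell_step bd asg v)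
  | xO i => if get i db is Some cl then clause_step asg cl else Some asg
  | xH => Some asg
  end.

Fixpoint refutes (bd : board) (db : trie (seq positive)) (asg : assignment)
    (hs : seq positive) : bool :=
  if hs is h :: hs then
    if hint_step bd db asg h is Some asg' then refutes bd db asg' hs else true
  else false.

Definition assume_not (cl : seq positive) (asg : assignment) : assignment :=
  foldl (fun a l => put (var l) (~~ sign l) a) asg cl.

(* Derived unit clauses are kept in an assignment, the others in a trie. *)
Definition theory := (assignment * trie (seq positive))%type.

Fixpoint check_lines (bd : board) (ls : seq line) (th : theory) :
    option theory :=
  if ls is Line cl hs i :: ls then
    let: (base, db) := th in
    if refutes bd db (assume_not cl base) hs then
      check_lines bd ls (if cl is [:: l] then (put (var l) (sign l) base, db)
                         else (base, put i cl db))
    else None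
  else Some th.

Fixpoint check_pages (bd : board) (pages : seq (seq line)) (th : theory) :
    option theory :=
  if pages is ls :: pages then
    if check_lines bd ls th is Some th' then check_pages bd pages th' else None
  else Some th.

Definition proves (bd : board) (pages : seq (seq line)) (gs : seq positive) :=
  if check_pages bd pages (Leaf, Leaf) is Some (base, _)
  then all (fun g => value base g == Some true) gs else false.

(** * Soundness of the checker *)

Definition agrees (X : positive -> bool) (asg : assignment) :=
  forall v b, get v asg = Some b -> X v = b.

Lemma agrees_put X asg v b : agrees X asg -> X v = b -> agrees X (put v b asg).
Proof.
by move=> XA Xv u c; rewrite get_put; case: eqP => [->[<-]|_ /XA].
Qed.

Lemma agrees_put_all X s asg : agrees X asg ->
  (forall vb, vb \in s -> X vb.1 = vb.2) -> agrees X (put_all s asg).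
Proof.
elim: s asg => //= vb s IHs asg XA Xs; apply: IHs => [|wb wbs].
  by apply: agrees_put => //; apply: Xs; rewrite mem_head.
by apply: Xs; rewrite inE wbs orbT.
Qed.

Lemma value_agrees X asg l : agrees X asg ->
  value asg l = Some (holds X l) \/ value asg l = None.
Proof.
rewrite /value /holds => XA.
case E: (get (var l) asg) => [b|] /=; last by right.
by left; rewrite (XA _ _ E).
Qed.

Lemma feasibleT X s c a b : a <= s <= b -> (forall x, c = Some x -> x = X) ->
  feasible (life_rule X s) c a b.
Proof.
move=> /andP[as_ sb] cX; rewrite /feasible /life_rule !inE.
have -> : (c != Some false) = ((c == None) || X).
  by case: c cX => [x|] // /(_ x erefl) ->; case: X.
have -> : (c != Some true) = ((c == None) || ~~ X).
  by case: c cX => [x|] // /(_ x erefl) ->; case: X.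
case: X {cX}; rewrite /= ?orbT ?orbF; case: ifP; case: (c == None) => /=; lia.
Qed.

(** The strict bounds justify [force]: if raising [a] (lowering [b]) by one is infeasible, every
    unknown neighbour is dead (alive). *)
Lemma tallyP (X : positive -> bool) (s : seq (positive * option bool)) a d :
    (forall u b, (u, Some b) \in s -> X u = b) -> tally s = (a, d) ->
  [/\ a <= \sum_(uo <- s) X uo.1, \sum_(uo <- s) X uo.1 + d <= size s,
      forall u, (u, None) \in s -> X u -> a < \sum_(uo <- s) X uo.1
    & forall u, (u, None) \in s -> ~~ X u ->
        \sum_(uo <- s) X uo.1 + d < size s].
Proof.
elim: s a d => [|[v o] s IHs] a d Xs /=; first by case=> <- <-; rewrite big_nil.
case Es: (tally s) IHs => [a' d'] /(_ a' d') IHs.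
have{IHs} [|//|a_le d_le aP dP] := IHs.
  by move=> u b us; apply: Xs; rewrite inE us orbT.
have -> : \sum_(j <- (v, o) :: s) X j.1 = X v + \sum_(uo <- s) X uo.1.
  by rewrite big_cons.
move: (\sum_(uo <- s) X uo.1) a_le d_le aP dP => S a_le d_le aP dP.
case: o Xs => [[]|] Xs [<- <-].
- have -> /= := Xs v true (mem_head _ _).
  by split=> [||u|u]; rewrite ?inE ?xpair_eqE ?andbF /=;
    [lia|lia|move=> /aP uX /uX; lia|move=> /dP uX /uX; lia].
- have -> /= := Xs v false (mem_head _ _).
  by split=> [||u|u]; rewrite ?inE ?xpair_eqE ?andbF /=;
    [lia|lia|move=> /aP uX /uX; lia|move=> /dP uX /uX; lia].
split=> [||u|u]; [lia|have := leq_b1 (X v); lia| |].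
- by rewrite inE => /predU1P[[->] -> /=|/aP uX /uX]; lia.
- rewrite inE => /predU1P[[->] /negPf-> /=|/dP uX /uX]; first by lia.
  by have := leq_b1 (X v); lia.
Qed.

Lemma mem_force b (s : seq (positive * option bool)) vc :
  vc \in force b s -> (vc.1, None) \in s /\ vc.2 = b.
Proof.
elim: s => [|[v [c|]] s IHs] //=.
  by move=> /IHs[vs ->]; rewrite inE vs orbT.
rewrite inE => /predU1P[->|/IHs[vs ->]]; first by rewrite mem_head.
by rewrite inE vs orbT.
Qed.

Lemma cell_stepP X bd asg v : satisfies X bd -> agrees X asg ->
  if cell_step bd asg v is Some s
  then forall vb, vb \in s -> X vb.1 = vb.2 else False.
Proof.
move=> XB XA; rewrite /cell_step.
case Ev: (get v bd) => [[[t|] us]|] //.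
have <- := XB _ _ _ Ev; set S := \sum_(u <- us) X u.
set nb := [seq _ | u <- us]; case Et: (tally nb) => [a d].
have Xnb u b : (u, Some b) \in nb -> X u = b.
  by case/mapP => w _ [-> /esym/XA].
have SE : \sum_(uo <- nb) X uo.1 = S by rewrite big_map.
have snb : size nb = size us by rewrite size_map.
have [] := tallyP Xnb Et; rewrite SE snb => a_le d_le aP dP.
set c := get v asg; have Xc b : c = Some b -> b = X v by move=> /XA.
have aSb : a <= S <= size us - d by lia.
rewrite (feasibleT aSb Xc) /=.
(* If the state [x] of the centre is infeasible, only its negation is left. *)
have feasibleN b b' x : a <= b <= S -> S <= b' ->
    ~~ feasible (life_rule (X v) S) (Some x) b b' -> X v = ~~ x.
  move=> abS Sb'; apply: contraNeq => xX; apply: feasibleT; first by lia.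
  by move=> _ [<-]; case: (X v) x xX => [] [].
move=> vb; rewrite mem_cat => /orP[].
  case: (c) => //.
  case: ifP => [/feasibleN Xv|_].
    by rewrite inE => /eqP->; apply: Xv; lia.
  case: ifP => [/feasibleN Xv|_] //; rewrite inE => /eqP->; apply: Xv; lia.
case: eqP => // _.
case: ifP => [/negP nf|_]; last case: ifP => [/negP nf|_] //.
  case/mem_force => vs ->; apply/negbTE/negP => /(aP _ vs) aS.
  by case: nf; apply: feasibleT => //; lia.
case/mem_force => vs ->; apply/negPn/negP => /(dP _ vs) dS.
by case: nf; apply: feasibleT => //; lia.
Qed.

Definition clauses_hold (X : positive -> bool) (db : trie (seq positive)) :=
  forall i cl, get i db = Some cl -> has (holds X) cl.

(** A literal true under [X] survives the filter, so the clause never becomes empty, and a single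
    survivor is that literal. *)
Lemma clause_stepP X asg cl : agrees X asg -> has (holds X) cl ->
  if clause_step asg cl is Some asg' then agrees X asg' else False.
Proof.
move=> XA /hasP[l lcl Xl]; rewrite /clause_step.
have : l \in [seq l <- cl | value asg l != Some false].
  by rewrite mem_filter lcl andbT; case: (value_agrees l XA) => ->; rewrite ?Xl.
case: [seq _ <- cl | _] => [|k [|? ?]] //; rewrite inE => /eqP <-.
by apply: agrees_put => //; apply/esym/eqP.
Qed.

Lemma hint_stepP X bd db asg h :
    satisfies X bd -> clauses_hold X db -> agrees X asg ->
  if hint_step bd db asg h is Some asg' then agrees X asg' else False.
Proof.
move=> XB Xdb XA; case: h => [v|i|] //=.
  have := cell_stepP v XB XA; case: cell_step => [s|] //= Xs.
  exact: agrees_put_all.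
by case E: (get i db) => [cl|] //; apply: clause_stepP => //; apply: Xdb E.
Qed.

Lemma refutesP X bd db asg hs : satisfies X bd -> clauses_hold X db ->
  refutes bd db asg hs -> ~ agrees X asg.
Proof.
move=> XB Xdb; elim: hs asg => //= h hs IHs asg rfl XA.
have := hint_stepP h XB Xdb XA; case: hint_step rfl => [asg'|] //.
exact: IHs.
Qed.

Lemma agrees_assume_not X cl asg : agrees X asg -> ~~ has (holds X) cl ->
  agrees X (assume_not cl asg).
Proof.
elim: cl asg => //= l cl IHcl asg XA; rewrite negb_or => /andP[Xl Xcl].
apply: IHcl => //; apply: agrees_put => //.
by move: Xl; rewrite /holds; case: (sign l) (X _) => [] [].
Qed.

Definition theory_holds X (th : theory) := agrees X th.1 /\ clauses_hold X th.2.

(** Reverse unit propagation: a clause whose negation propagates to a contradiction holds under [X],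
    and later lines may use it. *)
Lemma check_linesP X bd ls th th' : satisfies X bd -> theory_holds X th ->
  check_lines bd ls th = Some th' -> theory_holds X th'.
Proof.
move=> XB; elim: ls th => [|[cl hs i] ls IHs] [base db] [XA Xdb] /=.
  by case=> <-.
case: ifP => // rfl; apply: IHs.
have Xcl : has (holds X) cl.
  apply: contraT => Xcl; exfalso.
  exact: (refutesP XB Xdb rfl) (agrees_assume_not XA Xcl).
have Xput : clauses_hold X (put i cl db).
  by move=> j k; rewrite get_put; case: eqP => [_ [<-]|_ /Xdb].
case: cl Xcl Xput {rfl} => [|l [|? ?]] // Xl _.
split=> //; apply: agrees_put => //.
by move: Xl; rewrite /= orbF => /eqP.
Qed.

Lemma check_pagesP X bd pages th th' : satisfies X bd -> theory_holds X th ->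
  check_pages bd pages th = Some th' -> theory_holds X th'.
Proof.
move=> XB; elim: pages th => [|ls pages IHs] th Xth /=; first by case=> <-.
case E: check_lines => [th1|] //; apply: IHs.
exact: check_linesP E.
Qed.

Lemma provesP X bd pages gs : satisfies X bd -> proves bd pages gs ->
  all (holds X) gs.
Proof.
rewrite /proves => XB; case E: check_pages => [[base db]|] //.
have [|XA _] := check_pagesP XB _ E; first by split=> [] [].
apply: sub_all => g /eqP; case: (value_agrees g XA) => -> //.
by case.
Qed.

(** * Finding a refutation *)

(* Nothing is proved about the search below: its output is checked. *)

(* A priority queue: each node of the trie caches the best entry below it. *)
Definition entry := (N * positive)%type.

Inductive heap := Empty | Fork of option entry & option entry & heap & heap.

Definition best (h : heap) : option entry :=
  if h is Fork b _ _ _ then b else None.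

Definition better (x y : option entry) : option entry :=
  match x, y with
  | None, _ => y
  | _, None => x
  | Some (a, _), Some (b, _) => if BinNat.N.leb b a then x else y
  end.

Definition fork (x : option entry) (l r : heap) : heap :=
  Fork (better x (better (best l) (best r))) x l r.

Fixpoint hput (p : positive) (x : option entry) (h : heap) : heap :=
  match p, h with
  | xH, Empty => fork x Empty Empty
  | xH, Fork _ _ l r => fork x l r
  | xO q, Empty => fork None (hput q x Empty) Empty
  | xO q, Fork _ y l r => fork y (hput q x l) r
  | xI q, Empty => fork None Empty (hput q x Empty)
  | xI q, Fork _ y l r => fork y l (hput q x r)
  end.

(* [info] maps an assigned variable to the time of its assignment and to the
   reason for it, encoded as in [hints]; the reason [xH] marks a decision. *)
Record position := Position {
  asg : assignment; info : trie (positive * positive);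
  trail : seq positive; clock : positive }.

(* [stack] holds the positions before each decision. The first two literals of
   a clause are watched. The next goal is refuted first, as the decision at the
   bottom of [stack]. *)
Record solver := Solver {
  here : position; stack : seq position; queue : seq positive;
  clauses : trie (seq positive); watched : trie (seq positive);
  activity : trie N; pending : heap; fresh : positive;
  conflicts : N; since_restart : nat; log : seq line; goals : seq positive }.

Definition before (i j : positive) : bool := BinPos.Pos.ltb i j.

Definition time (s : position) (v : positive) : positive :=
  if get v (info s) is Some (t, _) then t else xH.
Definition reason (s : position) (v : positive) : positive :=
  if get v (info s) is Some (_, r) then r else xH.
Definition state (s : position) (v : positive) : bool :=
  odflt true (get v (asg s)).

Definition assign (s : position) (l r : positive) : position :=
  let: Position a i t c := s in
  Position (put (var l) (sign l) a) (put (var l) (c, r) i) (var l :: t)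
    (BinPos.Pos.succ c).

Definition enqueue (st : solver) (l r : positive) : solver :=
  let: Solver s k q d w a h n c e g o := st in
  Solver (assign s l r) k (var l :: q) d w a h n c e
    (if k is [::] then Line [:: l] [:: r] xH :: g else g) o.

Fixpoint enqueue_all (vs : seq (positive * bool)) (r : positive) (st : solver) :
    solver :=
  if vs is (v, b) :: vs then
    enqueue_all vs r
      (if get v (asg (here st)) is None then enqueue st (lit v b) r else st)
  else st.

Fixpoint propagate_cells (bd : board) (vs : seq positive) (st : solver) :
    solver * option positive :=
  if vs is v :: vs then
    if cell_step bd (asg (here st)) v is Some s
    then propagate_cells bd vs (enqueue_all s (xI v) st)
    else (st, Some (xI v))
  else (st, None).

Definition around (bd : board) (v : positive) : seq positive :=
  if get v bd is Some (_, us) then us else [::].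

Fixpoint find_watch (a : assignment) (ls acc : seq positive) :
    option (positive * seq positive) :=
  if ls is l :: ls then
    if value a l is Some false then find_watch a ls (l :: acc)
    else Some (l, catrev acc ls)
  else None.

Definition watchers (st : solver) (l : positive) : seq positive :=
  odflt [::] (get l (watched st)).

Definition set_watchers (l : positive) (ids : seq positive) (st : solver) :
    solver :=
  let: Solver s k q d w a h n c e g o := st in
  Solver s k q d (put l ids w) a h n c e g o.

Definition set_clause (i : positive) (cl : seq positive) (st : solver) :
    solver :=
  let: Solver s k q d w a h n c e g o := st in
  Solver s k q (put i cl d) w a h n c e g o.

(* The literal [f] has become false. *)
Fixpoint propagate_clauses (f : positive) (ids kept : seq positive)
    (st : solver) : solver * option positive :=
  if ids is i :: ids then
    if get i (clauses st) is Some [:: x, y & rest] then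
      let a := asg (here st) in
      let l := if x == f then y else x in
      match value a l with
      | Some true => propagate_clauses f ids (i :: kept) st
      | vl =>
        match find_watch a rest [::] with
        | Some (m, rest') =>
          propagate_clauses f ids kept
            (set_watchers m (i :: watchers st m)
              (set_clause i [:: l, m, f & rest'] st))
        | None =>
          if vl is Some false
          then (set_watchers f (catrev ids (i :: kept)) st, Some (xO i))
          else propagate_clauses f ids (i :: kept) (enqueue st l (xO i))
        end
      end
    else propagate_clauses f ids kept st
  else (set_watchers f kept st, None).

(* Keeps enough of the known cells (with their value, and whether they are the
   centre) for the constraint to remain violated; the counts [a], [d] and [c]
   include the cells kept so far and those that remain to be examined. *)
Fixpoint shrink (t : bool) (size : nat) (cells : seq (positive * bool * bool))
    (a d : nat) (c : option bool) (kept : seq positive) : seq positive :=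
  if cells is (u, b, centre) :: cells then
    let a' := if ~~ centre && b then a.-1 else a in
    let d' := if ~~ centre && ~~ b then d.-1 else d in
    let c' := if centre then None else c in
    if feasible t c' a' (size - d') then shrink t size cells a d c (u :: kept)
    else shrink t size cells a' d' c' kept
  else kept.

(* Cells assigned before [limit], with the value of [v] reversed. *)
Fixpoint gather (s : position) (ctr v limit : positive) (us : seq positive)
    (a d : nat) (c : option bool) (cells : seq (positive * bool * bool)) :
    seq (positive * bool * bool) * nat * nat * option bool :=
  if us is u :: us then
    if get u (asg s) is Some b then
      if (u == v) || before (time s u) limit then
        let b := b (+) (u == v) in
        let centre := u == ctr in
        gather s ctr v limit us
          (if ~~ centre && b then a.+1 else a)
          (if ~~ centre && ~~ b then d.+1 else d)
          (if centre then Some b else c)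
          (if u == v then cells else (u, b, centre) :: cells)
      else gather s ctr v limit us a d c cells
    else gather s ctr v limit us a d c cells
  else (cells, a, d, c).

(* Variables whose values imply, by the reason [r], that of [v]. *)
Definition explain (bd : board) (db : trie (seq positive)) (s : position)
    (r v limit : positive) : seq positive :=
  match r with
  | xO i => [seq u <- map var (odflt [::] (get i db)) | u != v]
  | xI w =>
    if get w bd is Some (Some t, us) then
      let: (cells, a, d, c) := gather s w v limit (w :: us) 0 0 None [::] in
      shrink t (size us) cells a d c [::]
    else [::]
  | xH => [::]
  end.

(* [unresolved] counts the marked variables of the current level that are still
   in the derived clause; [low] holds its literals from earlier levels. *)
Record analysis := Analysis {
  seen : trie unit; unresolved : nat; low : seq positive; used : seq positive;
  marked : seq positive }.

Fixpoint mark (s : position) (start1 start : positive) (us : seq positive)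
    (an : analysis) : analysis :=
  if us is u :: us then
    let t := time s u in
    mark s start1 start us
      (if before t start1 then an else
       if get u (seen an) is Some _ then an else
       let: Analysis sn op lo us ma := an in
       if before t start
       then Analysis (put u tt sn) op (lit u (~~ state s u) :: lo) us (u :: ma)
       else Analysis (put u tt sn) op.+1 lo us (u :: ma))
  else an.

(* Resolves until a single variable of the current level is left. *)
Fixpoint resolve (bd : board) (db : trie (seq positive)) (s : position)
    (start1 start : positive) (tr : seq positive) (an : analysis) :
    positive * analysis :=
  if tr is v :: tr then
    if get v (seen an) is Some _ then
      if unresolved an is 1 then (v, an) else
      let r := reason s v in
      let: Analysis sn op lo us ma := an in
      resolve bd db s start1 start tr
        (mark s start1 start (explain bd db s r v (time s v))
          (Analysis sn op.-1 lo (r :: us) ma))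
    else resolve bd db s start1 start tr an
  else (xH, an).

(** The literal falsified last becomes the second watch of the learnt clause, and its time decides
    how far to jump back. *)
Fixpoint latest_first (s : position) (m : positive) (t : positive)
    (ls acc : seq positive) : seq positive * positive :=
  if ls is l :: ls then
    let u := time s (var l) in
    if before t u then latest_first s l u ls (m :: acc)
    else latest_first s m t ls (l :: acc)
  else (m :: acc, t).

Fixpoint backjump (t : positive) (k : seq position) (s : position) :
    position * seq position :=
  if k is s' :: k' then
    if before t (clock s') then backjump t k' s' else (s, k)
  else (s, k).

Fixpoint reinsert (a : trie N) (s : position) (tr : seq positive)
    (stop : positive) (h : heap) : heap :=
  if tr is v :: tr then
    if before (time s v) stop then h
    else reinsert a s tr stop (hput v (Some (odflt N0 (get v a), v)) h)
  else h.

(* Activities are exponential moving averages of the conflict number. *)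
Definition bump (c : N) (ah : trie N * heap) (v : positive) : trie N * heap :=
  let x := odflt N0 (get v ah.1) in
  let y := BinNat.N.shiftr (BinNat.N.add (BinNat.N.sub (BinNat.N.shiftl x 5) x)
                                         (BinNat.N.shiftl c 8)) 5 in
  (put v y ah.1, hput v (Some (y, v)) ah.2).

Definition restart_interval := 30.

(** Learns the clause of the first unique implication point: [u] is its only literal from the
    current level. A learnt unit is asserted below all decisions; a conflict without decisions ends
    the search. *)
Definition conflict (bd : board) (st : solver) (r : positive) :
    solver + solver :=
  let: Solver s k q d w a h n c e g o := st in
  if k is top :: _ then
    let start := clock top in
    let start1 := clock (last top k) in
    let: (v, Analysis _ _ lo us ma) :=
      resolve bd d s start1 start (trail s)
        (mark s start1 start (explain bd d s r xH (clock s))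
          (Analysis Leaf 0 [::] [:: r] [::])) in
    let c := BinNat.N.succ c in
    let: (a, h) := foldl (bump c) (a, h) ma in
    let u := lit v (~~ state s v) in
    inl (if lo is x :: lo then
      let: (lo, t) := latest_first s x (time s (var x)) lo [::] in
      let restart := restart_interval <= e in
      let: (s', k') := backjump (if restart then xH else t) k s in
      let h := reinsert a s (trail s) (clock s') h in
      let y := head xH lo in
      let w := put u (n :: odflt [::] (get u w)) w in
      let w := put y (n :: odflt [::] (get y w)) w in
      let d := put n (u :: lo) d in
      let g := Line (u :: lo) us n :: g in
      let n' := BinPos.Pos.succ n in
      if restart then Solver s' k' [::] d w a h n' c 0 g o
      else Solver (assign s' u (xO n)) k' [:: v] d w a h n' c e.+1 g o
    else
      let: (s', k') := backjump xH k s in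
      let h := reinsert a s (trail s) (clock s') h in
      Solver (assign s' u xH) k' [:: v] d w a h n c e
        (Line [:: u] us xH :: g) o)
  else inr st.

Fixpoint open_goals (a : assignment) (gs : seq positive) : seq positive :=
  if gs is g :: gs' then
    if value a g is Some true then open_goals a gs' else gs
  else [::].

Definition decide (st : solver) : solver + solver :=
  let: Solver s k q d w a h n c e g o := st in
  if k is [::] then
    let o := open_goals (asg s) o in
    if o is l :: _ then
      inl (Solver (assign s (opp l) xH) [:: s] [:: var l] d w a h n c e g o)
    else inr (Solver s k q d w a h n c e g o)
  else if best h is Some (_, v) then
    let h := hput v None h in
    inl (if get v (asg s) is Some _ then Solver s k q d w a h n c e g o
         else
           Solver (assign s (lit v false) xH) (s :: k) [:: v] d w a h n c e g o)
  else inr st.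

Definition search_step (bd : board) (st : solver) : solver + solver :=
  let: Solver s k q d w a h n c e g o := st in
  if q is v :: q then
    let st := Solver s k q d w a h n c e g o in
    let: (st, r) := propagate_cells bd (v :: around bd v) st in
    let: (st, r) :=
      if r is Some _ then (st, r) else
      let f := lit v (~~ state (here st) v) in
      propagate_clauses f (watchers st f) [::] st in
    if r is Some r then conflict bd st r else inl st
  else decide st.

(* At most [2 ^ n] steps. *)
Fixpoint search (bd : board) (n : nat) (st : solver) : solver + solver :=
  if n is n'.+1 then
    match search bd n' st with inl st' => search bd n' st' | r => r end
  else search_step bd st.

(* The lines, given latest first, on which the derived unit clauses depend. *)
Fixpoint trim (needed : trie unit) (ls acc : seq line) : seq line :=
  if ls is Line cl hs i as x :: ls then
    if (size cl == 1) || (get i needed != None) then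
      trim (foldl (fun t h => if h is xO j then put j tt t else t) needed hs)
        ls (x :: acc)
    else trim needed ls acc
  else acc.

(* Pages keep the nesting depth of the certificate as a term small. *)
Fixpoint paginate (A : Type) (n room : nat) (s page : seq A) : seq (seq A) :=
  if s is x :: s then
    if room is room'.+1 then paginate n room' s (x :: page)
    else rev page :: paginate n n s [:: x]
  else [:: rev page].

(** The clock starts at 2, so that the time [xH] precedes every position and a backjump to it undoes
    all decisions. *)
Definition refutation (bd : board) (vs gs : seq positive) : seq (seq line) :=
  let h := foldr (fun v => hput v (Some (N0, v))) Empty vs in
  let st := Solver (Position Leaf Leaf [::] (xO xH)) [::] [::] Leaf Leaf Leaf
                   h xH N0 0 [::] gs in
  let ls := match search bd 22 st with inl st' | inr st' => log st' end in
  paginate 127 127 (trim Leaf ls [::]) [::].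

Import Order.TTheory GRing.Theory Num.Theory.

(** * Computing with configurations *)

Local Open Scope ring_scope.

Lemma game_of_lifeE x v :
  game_of_life x v = life_rule (x v) (\sum_(u <- moore) x (v + u)%R)%N.
Proof. by []. Qed.

Lemma fst_addE (u v : int * int) : (u + v).1 = u.1 + v.1.
Proof. by []. Qed.

Lemma snd_addE (u v : int * int) : (u + v).2 = u.2 + v.2.
Proof. by []. Qed.

Lemma moore_bound (u : int * int) :
  u \in moore -> (`|u.1| <= 1) && (`|u.2| <= 1).
Proof. by move: u; apply/allP; vm_compute. Qed.

Lemma game_of_life_dead x v : x v = false ->
  {in moore, forall u, x (v + u) = false} -> game_of_life x v = false.
Proof.
by move=> xv xu; rewrite game_of_lifeE xv big_seq big1 // => u /xu ->.
Qed.

Definition translate (t : int * int) (x : configuration) : configuration :=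
  fun v => x (v - t).

Lemma game_of_life_translate t x :
  game_of_life (translate t x) = translate t (game_of_life x).
Proof.
apply/funext => v; rewrite /translate !game_of_lifeE; congr life_rule.
by apply: eq_bigr => u _; rewrite addrAC.
Qed.

Lemma translateD s t x : translate s (translate t x) = translate (s + t) x.
Proof. by apply/funext => v; rewrite /translate opprD addrA. Qed.

Definition superpose (x y : configuration) : configuration :=
  fun v => x v || y v.

(** The rows [r + 1] and [r + 2] are empty, so no cell has both figures in its neighbourhood. *)
Lemma game_of_life_superpose (x y : configuration) (r : int) :
    (forall v, x v -> v.1 <= r) -> (forall v, y v -> r + 2 < v.1) ->
  game_of_life (superpose x y) = superpose (game_of_life x) (game_of_life y).
Proof.
move=> xr yr; apply/funext => v; rewrite /superpose.
have [vr|vr] := leP v.1 (r + 1).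
  have y0 (w : int * int) : w.1 <= v.1 + 1 -> y w = false.
    by move=> wv; apply/negP => /yr; lia.
  rewrite (@game_of_life_dead y); last 2 first.
  - by apply: y0; lia.
  - by move=> u /moore_bound /andP[u1 _]; apply: y0; rewrite fst_addE; lia.
  rewrite orbF !game_of_lifeE y0 ?orbF; last by lia.
  congr life_rule; rewrite big_seq [RHS]big_seq; apply: eq_bigr => u.
  by move=> /moore_bound /andP[u1 _]; rewrite y0 ?orbF // fst_addE; lia.
have x0 (w : int * int) : v.1 - 1 <= w.1 -> x w = false.
  by move=> wv; apply/negP => /xr; lia.
rewrite (@game_of_life_dead x); last 2 first.
- by apply: x0; lia.
- by move=> u /moore_bound /andP[u1 _]; apply: x0; rewrite fst_addE; lia.
rewrite !game_of_lifeE x0 //=; last by lia.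
congr life_rule; rewrite big_seq [RHS]big_seq; apply: eq_bigr => u.
by move=> /moore_bound /andP[u1 _]; rewrite x0 // fst_addE; lia.
Qed.

Definition box (o : int * int) (h w : nat) : seq (int * int) :=
  [seq (o.1 + i%:Z, o.2 + j%:Z) | i <- iota 0 h, j <- iota 0 w].

Lemma mem_box o h w v : (v \in box o h w) =
  [&& o.1 <= v.1, v.1 < o.1 + h%:Z, o.2 <= v.2 & v.2 < o.2 + w%:Z].
Proof.
case: v => a b; apply/idP/idP => [/allpairsP[[i j]]|/and4P[/= oa ah ob bw]].
  by rewrite !mem_iota /= => -[ih jw [-> ->]]; lia.
apply/allpairsP; exists (`|(a - o.1)%R|%N, `|(b - o.2)%R|%N).
rewrite !mem_iota /=.
by split; [lia|lia|congr pair; lia].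
Qed.

(** A form of the rule that evaluates, with [sumn] in place of the big sum. *)
Definition next (x : configuration) (v : int * int) : bool :=
  life_rule (x v) (sumn [seq x (v + u) : nat | u <- moore]).

Lemma nextE x : next x =1 game_of_life x.
Proof. by move=> v; rewrite /next sumnE big_map. Qed.

Lemma game_of_life_box (x y : configuration) (o : int * int) (h w : nat) :
    (forall v, x v -> v \in box (o + (1, 1)) h w) ->
    (forall v, y v -> v \in box o h.+2 w.+2) ->
    all (fun v => next x v == y v) (box o h.+2 w.+2) ->
  game_of_life x = y.
Proof.
move=> xb yb /allP xy; apply/funext => v.
have [/xy/eqP <-|vb] := boolP (v \in box o h.+2 w.+2); first by rewrite nextE.
have -> : y v = false by apply: contraNF vb => /yb.
move: vb; rewrite mem_box => vb; apply: game_of_life_dead => [|u].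
  by apply: contraNF vb => /xb; rewrite mem_box ?fst_addE ?snd_addE /=; lia.
move=> /moore_bound u1; apply: contraNF vb => /xb.
by move: u1; rewrite mem_box ?fst_addE ?snd_addE /=; lia.
Qed.

(** * Drawn patterns, and evolution inside a shrinking window *)

Fixpoint cells_of (s : string) : seq bool :=
  if s is String c s then Ascii.eqb c "O" :: cells_of s else [::].

Definition plot (f : seq (seq bool)) : configuration := fun v =>
  if v is (Posz i, Posz j) then nth false (nth [::] f i) j else false.

Lemma plot_box f h w v : size f = h -> all (fun s => size s == w) f ->
  plot f v -> v \in box (0, 0) h w.
Proof.
move=> <- /allP fw; rewrite mem_box; case: v => [[i|i] [j|j]] //= fij.
have ih : (i < size f)%N 
  by rewrite ltnNge; apply: contraL fij => fi;
    rewrite (nth_default _ fi) nth_nil.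
have /eqP jw := fw _ (mem_nth [::] ih).
suff : (j < w)%N by lia.
by rewrite -jw ltnNge; apply: contraL fij => fj; rewrite nth_default.
Qed.

Definition window (x : configuration) (o : int * int) (f : nat -> nat -> bool)
    (h w : nat) :=
  forall i j, (i < h)%N -> (j < w)%N -> x (o.1 + i%:Z, o.2 + j%:Z) = f i j.

Definition entry_of (f : seq (seq bool)) (i j : nat) : bool :=
  nth false (nth [::] f i) j.

Definition tabulate (f : nat -> nat -> bool) (h w : nat) : seq (seq bool) :=
  mkseq (fun i => mkseq (f i) w) h.

Definition inner_next (f : nat -> nat -> bool) (i j : nat) : bool :=
  life_rule (f i.+1 j.+1)
    (f i j + (f i j.+1 + (f i j.+2 + (f i.+1 j + (f i.+1 j.+2 +
      (f i.+2 j + (f i.+2 j.+1 + f i.+2 j.+2)))))))%N.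

(** A margin of one cell is lost per generation, as border cells have unknown neighbours. Tables
    keep each value from being recomputed for all its neighbours. *)
Fixpoint inner_iter (k h w : nat) (f : seq (seq bool)) : seq (seq bool) :=
  if k is k'.+1 then
    inner_iter k' h.-2 w.-2 (tabulate (inner_next (entry_of f)) h.-2 w.-2)
  else f.

Lemma window_tabulate x o f h w : window x o f h w ->
  window x o (entry_of (tabulate f h w)) h w.
Proof. by move=> xf i j ih jw; rewrite xf // /entry_of !nth_mkseq. Qed.

Lemma window_next x o f h w : window x o f h.+2 w.+2 ->
  window (game_of_life x) (o + (1, 1)) (inner_next f) h w.
Proof.
move=> xf i j ih jw; rewrite game_of_lifeE /inner_next.
have E a b (di dj : int) : (a < h.+2)%N -> (b < w.+2)%N ->
    a%:Z = i%:Z + 1 + di -> b%:Z = j%:Z + 1 + dj ->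
    x ((o + (1, 1)).1 + i%:Z + di, (o + (1, 1)).2 + j%:Z + dj) = f a b.
  by move=> ah bw ai bj; rewrite -xf //; congr x; congr pair => /=; lia.
congr life_rule.
  by rewrite -(E i.+1 j.+1 0 0) ?addr0 //; lia.
have -> : moore = [:: (-1, -1); (-1, 0); (-1, 1); (0, -1); (0, 1);
                      (1, -1); (1, 0); (1, 1)] by vm_compute.
rewrite !big_cons big_nil /= addn0.
by do ![congr addn]; congr nat_of_bool; apply: E; rewrite /=; lia.
Qed.

Lemma window_iter k x o f h w : window x o (entry_of f) (h + k.*2) (w + k.*2) ->
  window (iter k game_of_life x) (o + (k%:Z, k%:Z))
    (entry_of (inner_iter k (h + k.*2) (w + k.*2) f)) h w.
Proof.
elim: k x o f => [|k IHk] x o f xf /=.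
  by move=> i j ih jw; rewrite -xf ?addn0 // !addr0.
rewrite -iterS iterSr !doubleS !addnS /=.
have -> : o + ((k.+1)%:Z, (k.+1)%:Z) = o + (1, 1) + (k%:Z, k%:Z).
  by rewrite -addrA; congr (_ + _); congr pair; rewrite /= -addn1 PoszD addrC.
apply: IHk; apply: window_tabulate; apply: window_next.
by move: xf; rewrite !doubleS !addnS.
Qed.

(** * A pattern with a unique preimage *)

Definition still_life : configuration := plot (map cells_of [::
   "--------------------------";
   "-----OO----O-----O--------";
   "----O--O--O-O---O-O--OO---";
   "---O--O--O--O---O--O--O---";
   "---O-OO-OO-OO-OO-OO-OO----";
   "--OO--O--O--O--O--O--O-O--";
   "-O--O--O--O--O--O--O--O-O-";
   "-OO-OO-OO-OO-OO-OO-OO-O-O-";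
   "--O-O--O--O--O--O--O--OO--";
   "--O---O--O--O--O--O--O----";
   "---OOO-OO-OO-OO-OO-OO-OO--";
   "-----O--O--O--O--O--O--O--";
   "------O--O--O--O--O--O----";
   "-O-OOO-OO-OO-OO-OO-OO-----";
   "-OO-O--O--O--O--O--O------";
   "------O--O--O--O--O--O-OO-";
   "-----OO-OO-OO-OO-OO-OOO-O-";
   "----O--O--O--O--O--O------";
   "--O--O--O--O--O--O--O-----";
   "--OO-OO-OO-OO-OO-OO-OOO-O-";
   "----O--O--O--O--O--O---OO-";
   "--OO--O--O--O--O--O--O----";
   "-O-O-OO-OO-OO-OO-OO-OO-OO-";
   "-O-O--O--O--O--O--O--O--O-";
   "--O-O--O--O--O--O--O--OO--";
   "----OO-OO-OO-OO-OO-OO-O---";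
   "---O--O--O---O--O--O--O---";
   "---OO--O-O---O--O--O-O----";
   "--------O-----OO----O-----";
   "--------------------------"]%string).

Lemma still_life_box v : still_life v -> v \in box (0, 0) 30 26.
Proof. exact: plot_box. Qed.

Lemma game_of_life_still_life : game_of_life still_life = still_life.
Proof.
apply: (@game_of_life_box _ _ (-1, -1) 30 26) => [v|v /still_life_box|].
- exact: still_life_box.
- by rewrite !mem_box /=; lia.
- by vm_compute.
Qed.

Definition region : seq (int * int) := box (3, 4) 24 18.

(** Injective only for nonnegative rows and columns from 0 to 31, which covers [region] and its
    neighbours. *)
Definition code (v : int * int) : positive :=
  BinPos.Pos.of_succ_nat (32 * `|v.1| + `|v.2|)%N.

Definition decode (p : positive) : int * int :=
  let n := (BinPos.Pos.to_nat p).-1 in ((n %/ 32)%:Z, (n %% 32)%:Z).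

Lemma codeK (v : int * int) : 0 <= v.1 -> 0 <= v.2 < 32 -> decode (code v) = v.
Proof.
case: v => -[i|//] [j|//] _ /= j32; rewrite /decode /code.
rewrite Pnat.SuccNat2Pos.id_succ [(32 * _)%N]mulnC /=.
by rewrite divnMDl ?modnMDl // divn_small ?modn_small ?addn0.
Qed.

Lemma region_codeK (v : int * int) : v \in region -> decode (code v) = v.
Proof. by rewrite mem_box /= => vR; apply: codeK; lia. Qed.

Lemma region_moore_codeK (v u : int * int) : v \in region -> u \in moore ->
  decode (code (v + u)) = v + u.
Proof.
rewrite mem_box /= => vR /moore_bound u1.
by apply: codeK; rewrite ?fst_addE ?snd_addE; lia.
Qed.

Definition neighbours (v : int * int) : seq positive :=
  [seq code (v + u) | u <- moore].

(** Cells on the margin of [region] are unconstrained; their entries tell the search which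
    constraints to revisit when they are assigned. *)
Definition life_board : board :=
  put_all [seq (code v, (Some (still_life v), neighbours v)) | v <- region]
    (put_all [seq (code v, (None, neighbours v)) | v <- box (2, 3) 26 20] Leaf).

Lemma life_board_satisfied (x : configuration) :
  {in region, game_of_life x =1 still_life} ->
  satisfies (x \o decode) life_board.
Proof.
move=> xR p t us /get_put_all[|].
  case/mapP => v vR [-> -> ->]; rewrite -(xR _ vR) game_of_lifeE /=.
  rewrite region_codeK //; congr life_rule.
  rewrite big_map big_seq [RHS]big_seq.
  by apply: eq_bigr => u /(region_moore_codeK vR) ->.
by case/get_put_all => [/mapP[]//|]; case: p.
Qed.

Definition life_literal (v : int * int) : positive :=
  lit (code v) (still_life v).

(* Proving the cells from the centre [(29 / 2, 25 / 2)] outwards is fast. *)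
Definition life_goals : seq positive :=
  let dist (v : int * int) := 
    maxn `|(2 * v.1 - 29)%R|%N `|(2 * v.2 - 25)%R|%N in
  map life_literal (sort (relpre dist leq) region).

Definition life_refutation : seq (seq line) :=
  refutation life_board [seq code v | v <- box (2, 3) 26 20] life_goals.

Definition certificate : seq (seq line) := Eval vm_compute in life_refutation.

Lemma certificate_proves : proves life_board certificate life_goals.
Proof. by vm_compute. Qed.

(** Read through [decode], [x] satisfies the constraints of [life_board], so every goal proved by
    the certificate holds for it. *)
Lemma region_preimage (x : configuration) :
  {in region, game_of_life x =1 still_life} -> {in region, x =1 still_life}.
Proof.
move=> /life_board_satisfied xB v vR.
have vG : life_literal v \in life_goals by apply: map_f; rewrite mem_sort.
have := allP (provesP xB certificate_proves) _ vG.
by rewrite holds_lit => /eqP ->; rewrite /comp (region_codeK vR).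
Qed.

(** * A glider that destroys the pattern *)

(** Blank rows and columns keep all four phases in the same coordinates. *)
Definition glider_phase (k : nat) : configuration := plot (map cells_of
  (nth [::] [:: [:: "-O-"; "--O"; "OOO"];
                [:: "---"; "O-O"; "-OO"; "-O-"];
                [:: "---"; "--O"; "O-O"; "-OO"];
                [:: "----"; "-O--"; "--OO"; "-OO-"]]%string k)).

Lemma glider_phase_box k v : glider_phase k v -> v \in box (0, 0) 4 4.
Proof.
have plot_box4 h w f : (h <= 4)%N -> (w <= 4)%N -> size f = h ->
    all (fun s => size s == w) f -> plot f v -> v \in box (0, 0) 4 4.
  move=> h4 w4 fh fw /(plot_box fh fw); rewrite !mem_box /=; lia.
case: k => [|[|[|[|k]]]]; first exact: (@plot_box4 3 3).
- exact: (@plot_box4 4 3).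
- exact: (@plot_box4 4 3).
- exact: (@plot_box4 4 4).
- rewrite /glider_phase /= nth_nil.
  by case: v plot_box4 => [[i|i] [j|j]] //= _; rewrite !nth_nil.
Qed.

Lemma game_of_life_glider k : (k < 3)%N ->
  game_of_life (glider_phase k) = glider_phase k.+1.
Proof.
move=> k3; apply: (@game_of_life_box _ _ (-1, -1) 4 4) => [v|v|].
- exact: glider_phase_box.
- by move=> /glider_phase_box; rewrite !mem_box /=; lia.
- by case: k k3 => [|[|[|k]]] // _; vm_compute.
Qed.

Lemma game_of_life_glider3 :
  game_of_life (glider_phase 3) = translate (1, 1) (glider_phase 0).
Proof.
apply: (@game_of_life_box _ _ (-1, -1) 4 4) => [v|v|].
- exact: glider_phase_box.
- rewrite /translate => /plot_box -/(_ 3 3 erefl erefl).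
  by rewrite !mem_box /=; lia.
- by vm_compute.
Qed.

(* The glider, [4 * m] generations before it is next to the still life. *)
Definition attack (m : nat) : configuration :=
  superpose (translate (- 5 - m%:Z, 3 - m%:Z) (glider_phase 0)) still_life.

Lemma attack_iter m : iter 4 game_of_life (attack m.+1) = attack m.
Proof.
pose t : int * int := (- 5 - m.+1%:Z, 3 - m.+1%:Z).
have step k :
    game_of_life (superpose (translate t (glider_phase k)) still_life) =
    superpose (translate t (game_of_life (glider_phase k))) still_life.
  (* All phases at [t] lie in rows up to -3, and the still life in rows from 0 on. *)
  rewrite (@game_of_life_superpose _ _ (- 3)).
  - by rewrite game_of_life_translate game_of_life_still_life.
  - by move=> v /glider_phase_box; rewrite mem_box /=; lia.
  - by move=> v /still_life_box; rewrite mem_box /=; lia.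
rewrite /attack /= -/t step (@game_of_life_glider 0) // step.
rewrite (@game_of_life_glider 1) // step (@game_of_life_glider 2) // step.
rewrite game_of_life_glider3.
have tE : t + (1, 1) = (- 5 - m%:Z, 3 - m%:Z).
  by apply: injective_projections; rewrite ?fst_addE ?snd_addE /=; lia.
by rewrite translateD tE.
Qed.

Lemma attack_limit_set m : limit_set game_of_life (attack m).
Proof.
(* From [attack (m + n)] it takes [4 * n] generations to reach [attack m]: the witness uses [3 * n]
   of them and leaves [n]. *)
move=> n _; exists (iter (3 * n) game_of_life (attack (m + n))) => //.
rewrite -iterD -mulSn; elim: n => [|n IHn]; first by rewrite addn0.
by rewrite mulnSr iterD addnS attack_iter.
Qed.

(* The cell [(3, 6)] of [region] dies in the ninth generation, which depends on
   the square of side 19 centred at it only. *)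
Lemma attack_destroys (x : configuration) :
    {in box (-6, -3) 19 19, x =1 attack 0} ->
  iter 9 game_of_life x (3, 6) != still_life (3, 6).
Proof.
move=> xa.
pose f := tabulate (fun i j => attack 0 (-6 + i%:Z, -3 + j%:Z)) 19 19.
have xf : window x (-6, -3) (entry_of f) 19 19.
  apply: window_tabulate => i j i19 j19; apply: xa.
  by rewrite mem_box /=; lia.
have -> : iter 9 game_of_life x (3, 6) = entry_of (inner_iter 9 19 19 f) 0 0.
  exact: (@window_iter 9 x (-6, -3) f 1 1 xf 0%N 0%N isT isT).
by vm_compute.
Qed.

(** * Dynamics on the limit set *)

Local Open Scope classical_set_scope.

Lemma open_agree_on (s : seq (int * int)) (z : configuration) :
  open [set x : configuration | {in s, x =1 z}].
Proof.
elim: s => [|v s IHs].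
  by rewrite (_ : [set _ | _] = setT); [apply: openT | apply/seteqP; split].
rewrite (_ : [set _ | _] = [set x : configuration | x v = z v] `&`
                           [set x : configuration | {in s, x =1 z}]).
  apply: openI IHs.
  have : open ((@proj _ (fun=> bool) v : configuration -> bool) @^-1`
               [set z v]).
    apply: open_comp => [? _|]; first exact: proj_continuous.
    exact: discrete_open.
  by [].
apply/seteqP; split=> x /= => [xz|[xv xs] u].
  by split=> [|u us]; apply: xz; [exact: mem_head | rewrite inE us orbT].
by rewrite inE => /predU1P[->|/xs].
Qed.

Notation life_limit_set := (limit_set game_of_life).
Notation life_restr := (restr_limit_set game_of_life).

Lemma open_limit_set_agree_on (s : seq (int * int)) (z : configuration) :
  open [set x : life_limit_set | {in s, set_val x =1 z}].
Proof. by eexists; [apply: (open_agree_on s z) | ]. Qed.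

Lemma set_val_iter n (x : life_limit_set) :
  set_val (iter n life_restr x) = iter n game_of_life (set_val x).
Proof. by elim: n => //= n <-. Qed.

(** The cylinder of the still life on [region] cannot be entered from outside. *)
Lemma region_preimage_iter n (x : configuration) :
  {in region, iter n game_of_life x =1 still_life} ->
  {in region, x =1 still_life}.
Proof. by elim: n x => // n IHn x; rewrite iterSr => /IHn/region_preimage. Qed.

Lemma attack_region : {in region, attack 0 =1 still_life}.
Proof.
move=> v; rewrite /attack /superpose /translate => vR.
case: (boolP (glider_phase _ _)) => // /glider_phase_box.
by move: vR; rewrite !mem_box /=; lia.
Qed.

Definition attack_point : life_limit_set :=
  SigSub (mem_set (attack_limit_set 0)).

Theorem theorem25 :
  ~ topologically_transitive (restr_limit_set game_of_life) /\
  ~ has_dense_periodic_points (restr_limit_set game_of_life).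
Proof.
have R36 : (3, 6) \in region by [].
have attack9 : iter 9 game_of_life (attack 0) (3, 6) != still_life (3, 6).
  exact: attack_destroys.
split.
  (* Points of [U] differ from the still life at [(3, 6)], a cell of [region], so their orbits never
     enter [V]. *)
  pose U := [set x : life_limit_set |
    {in [:: (3, 6)], set_val x =1 iter 9 game_of_life (attack 0)}].
  pose V := [set x : life_limit_set | {in region, set_val x =1 still_life}].
  move=> /(_ U V); case; [exact: open_limit_set_agree_on..| | |].
  - by exists (iter 9 life_restr attack_point) => v _; rewrite set_val_iter.
  - by exists attack_point; apply: attack_region.
  move=> n [_ [[x Ux <-]]]; rewrite /V /= set_val_iter => /region_preimage_iter.
  by move=> /(_ _ R36); rewrite Ux ?mem_head //; apply/eqP.
(* The square determines [(3, 6)] nine generations later; [region] makes the points of [W] start in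
   the cylinder. *)
pose W := [set x : life_limit_set |
  {in box (-6, -3) 19 19 ++ region, set_val x =1 attack 0}].
move=> /(_ W) []; [by exists attack_point|exact: open_limit_set_agree_on|].
move=> x [Wx [n n1 xn]].
have xR : {in region, set_val x =1 still_life}.
  by move=> v vR; rewrite Wx ?attack_region // mem_cat vR orbT.
have /eqP[] : iter 9 game_of_life (set_val x) (3, 6) != still_life (3, 6).
  by apply: attack_destroys => v vB; rewrite Wx // mem_cat vB.
(* As [n >= 1], the ninth image returns to [x] after [n * 9 - 9] more generations, [n * 9] being a
   multiple of the period; so it would already lie in the cylinder. *)
apply: (@region_preimage_iter (n * 9 - 9)) R36.
rewrite -iterD subnK; last by rewrite leq_pmull.
suff -> : iter (n * 9) game_of_life (set_val x) = set_val x by [].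
rewrite -set_val_iter; congr set_val.
by elim: 9%N => [|k IHk]; rewrite ?muln0 // mulnS iterD IHk.
Qed.
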